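(* Let $\alpha$ be a positive integer and $a,b,\beta>0$, and let $\phi_k$, $k=0,1,2,\ldots$, be the coefficients in the expansion $$I_x(a,b+\alpha)\,I_x(a,b+\beta)-I_x(a,b)\,I_x(a,b+\alpha+\beta)=x^{2a}(1-x)^{2b+\alpha+\beta}\sum_{k=0}^{\infty}\phi_kx^k,\qquad x\in(0,1).$$ Then for all $k\ge0$ $$ \phi_k=\sum_{j=0}^{\alpha-1}\frac{a\,\Gamma(a+b+j)\,\Gamma(a+b+\beta+\alpha-j-1)}{[\Gamma(a+1)]^2\,\Gamma(b+j+1)\,\Gamma(b+\beta+\alpha-j)\,(a+1)_k}\left\{(a+b+\beta+\alpha-j-1)_{k+1}-(a+b+j)_{k+1}\right\}. $$ If, furthermore, $\beta\ge\alpha-1$ and $\beta>0$, then $\phi_k>0$ for all $k\ge0$.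
   Context: For $a,b>0$ and $x\in(0,1)$, $I_x(a,b)=\dfrac{\int_0^x t^{a-1}(1-t)^{b-1}dt}{\int_0^1 t^{a-1}(1-t)^{b-1}dt}$ is the normalized incomplete beta function. It satisfies $I_x(a,b)=x^a(1-x)^b\sum_{n=0}^\infty\frac{\Gamma(a+b+n)}{\Gamma(b)\Gamma(a+1+n)}x^n$, so that the coefficients $\phi_k$ in the claim are well defined. $(p)_0=1$ and $(p)_n=p(p+1)\cdots(p+n-1)$ is the Pochhammer symbol. *)

(* Defs.v *)
From HB Require Import structures.
From mathcomp Require Export all_boot all_order all_algebra.
From mathcomp Require Export all_classical all_reals all_analysis.

Set Implicit Arguments.
Unset Strict Implicit.
Unset Printing Implicit Defensive.

Import Order.TTheory GRing.Theory Num.Theory.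
Import numFieldNormedType.Exports.

Local Open Scope classical_set_scope.
Local Open Scope ring_scope.

(* Euler's integral; the meaningful range is 0 < s, where it converges. *)
Definition Gamma (R : realType) (s : R) : R :=
  \int[@lebesgue_measure R]_(t in `]0, +oo[) (t `^ (s - 1) * expR (- t)).

(* The interval is open so that the possibly singular end points 0 and 1 are
   left out; this does not affect the Lebesgue integral. *)
Definition incomplete_beta (R : realType) (a b x : R) : R :=
  \int[@lebesgue_measure R]_(t in `]0, x[)
     (t `^ (a - 1) * (1 - t) `^ (b - 1)).

Definition normalized_incomplete_beta (R : realType) (x a b : R) : R :=
  incomplete_beta a b x / incomplete_beta a b 1.

Definition pochhammer (R : realType) (p : R) (n : nat) : R :=
  \prod_(i < n) (p + i%:R).

Definition turan_difference (R : realType) (a b alpha beta x : R) : R :=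
  let I := normalized_incomplete_beta x in
  I a (b + alpha) * I a (b + beta) - I a b * I a (b + alpha + beta).

(* Convergence of the power series is required separately because [limn] of a
   divergent sequence is an arbitrary value. *)
Definition turan_expansion (R : realType) (a b alpha beta : R)
    (phi : nat -> R) : Prop :=
  forall x : R, 0 < x < 1 ->
    cvgn (pseries phi x) /\
    turan_difference a b alpha beta x =
      x `^ (2 * a) * (1 - x) `^ (2 * b + alpha + beta) * limn (pseries phi x).

(* Main.v *)
Require Import Defs.
From mathcomp Require Import measurable_realfun ring lra.
Import Order.TTheory GRing.Theory Num.Theory.
Import numFieldNormedType.Exports.
Set Implicit Arguments.
Unset Strict Implicit.
Unset Printing Implicit Defensive.
Local Open Scope classical_set_scope.
Local Open Scope ring_scope.

(** Every term of the telescoping sum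
    I(b+alpha) I(b+beta) - I(b) I(b+alpha+beta)
      = sum_j [I(q+1) I(r) - I(q) I(r+1)],   q = b+j, r = b+beta+alpha-j-1,
    with I(c) = I_x(a,c), can be written as
      (I(q+1) - I(q)) I(r+1) - I(q+1) (I(r+1) - I(r)).
    Here I(q+1) - I(q) = x^a (1-x)^q Gamma(a+q) / (Gamma(a) Gamma(q+1)) is a
    monomial, and iterating the recursion
      a B_x(a,c) = x^a (1-x)^c + (a+c) B_x(a+1,c)
    gives the power series of I(c) / (x^a (1-x)^c), so the coefficients can be
    read off and compared with phi on (0,1).  The constants come from
    Gamma(a) Gamma(b) = Gamma(a+b) B(a,b), which is Tonelli's theorem for the
    convolution of two gamma densities. *)

(** * Fundamental theorem of calculus on an open interval with singular end points *)

Section ftc_oo.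
Context {R : realType}.
Implicit Types (F u v : R -> R) (x : R).
Local Notation mu := (@lebesgue_measure R).

(* Allowing F' = u - v with u, v >= 0, rather than a single nonnegative F',
   transfers finiteness from the integral of v to that of u. *)
Lemma ge0_integral_oo_FTC2 F u v x (F0 Fx : R) : 0 < x ->
  {in `]0, x[, continuous u} -> {in `]0, x[, continuous v} ->
  {in `]0, x[, forall t, 0 <= u t} -> {in `]0, x[, forall t, 0 <= v t} ->
  (forall t, 0 < t < x -> is_derive t 1 F (u t - v t)) ->
  F t @[t --> 0^'+] --> F0 -> F t @[t --> x^'-] --> Fx ->
  (\int[mu]_(t in `]0%R, x[) (u t)%:E =
    (Fx - F0)%:E + \int[mu]_(t in `]0%R, x[) (v t)%:E)%E.
Proof.
move=> x0 cu cv u0 v0 dF FF0 FFx.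
(* With n + 3 in the denominator, 2 [p n] < x already at n = 0, so every segment [[p n], x - [p n]]
   is nondegenerate; these segments exhaust ]0, x[. *)
pose p n := x / n.+3%:R.
have p_gt0 n : 0 < p n by rewrite divr_gt0.
have p_lt n : p n < x - p n.
  rewrite ltrBrDr -mulr2n /p -mulrnAr -[ltRHS]mulr1 ltr_pM2l//.
  by rewrite -mulr_natl ltr_pdivrMr// mul1r ltr_nat.
have pxlt n : x - p n < x by rewrite ltrBlDr ltrDl.
have p0 : p n @[n --> \oo] --> (0 : R).
  rewrite -[0](mulr0 x); apply: cvgM; first exact: cvg_cst.
  have := @cvg_harmonic R; rewrite -(cvg_shiftn 2) => h.
  by apply: cvg_trans h; apply: near_eq_cvg; near=> n; rewrite /= addn2.
pose S n := `[p n, x - p n]%classic.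
have SS n : S n `<=` `]0, x[%classic.
  move=> t; rewrite /S /= !in_itv/= => /andP[pt tp].
  by rewrite (lt_le_trans (p_gt0 n) pt) (le_lt_trans tp).
have US : \bigcup_n S n = `]0, x[%classic.
  apply/seteqP; split=> [t [n _ /SS]//|t]; rewrite /= in_itv/= => /andP[t0 tx].
  have /cvgrPdist_lt /(_ (Num.min t (x - t))) := p0.
  rewrite lt_min t0 subr_gt0 tx => /(_ isT)[N _ /(_ N (leqnn N))]/=.
  rewrite sub0r normrN (gtr0_norm (p_gt0 N)) lt_min => /andP[/ltW a /ltW b].
  by exists N => //; rewrite /S/= in_itv/= a/= lerBrDr addrC -lerBrDr.
have ndS : nondecreasing_seq S.
  move=> m n mn; apply/subsetPset => t; rewrite /S /= !in_itv/= => /andP[pt tp].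
  have pp : p n <= p m by rewrite /p ler_pM2l// lef_pV2 ?posrE// ler_nat !ltnS.
  by rewrite (le_trans pp pt) (le_trans tp)// lerB.
have mS n : measurable (S n : set (measurableTypeR R)) by exact: measurable_itv.
have sub (w : R -> R) : {in `]0, x[, continuous w} ->
    measurable_fun `]0, x[%classic w.
  move=> cw; apply: open_continuous_measurable_fun => // t.
  by rewrite inE; exact: cw.
have subS (w : R -> R) n : {in `]0, x[, continuous w} ->
    {within S n, continuous w}.
  move=> cw; apply: continuous_in_subspaceT => t; rewrite inE => /SS.
  exact: cw.
have iS (w : R -> R) n : {in `]0, x[, continuous w} ->
    mu.-integrable (S n) (EFin \o w).
  move=> cw; apply: continuous_compact_integrable; last exact: subS.
  exact: segment_compact.
have cvgS (w : R -> R) : {in `]0, x[, continuous w} ->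
    {in `]0, x[, forall t, 0 <= w t} ->
    (\int[mu]_(t in S n) (w t)%:E)%E @[n --> \oo] -->
      (\int[mu]_(t in `]0%R, x[) (w t)%:E)%E.
  move=> cw w0; rewrite -US; apply: ge0_nondecreasing_set_cvg_integral => //.
    move=> n; apply/measurable_EFinP.
    by apply: measurable_funS (sub _ cw) => //; exact: SS.
  by move=> n t /SS/= xt; rewrite lee_fin w0.
(* On a compact piece u and v are both integrable, so the integral of F' = u - v may be split. *)
have FTC n : (\int[mu]_(t in S n) (u t)%:E =
    (F (x - p n) - F (p n))%:E + \int[mu]_(t in S n) (v t)%:E)%E.
  have : (\int[mu]_(t in S n) (u t - v t)%:E =
      (F (x - p n))%:E - (F (p n))%:E)%E.
    have dd t : p n <= t <= x - p n -> derivable F t 1.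
      move=> /andP[a b]; have [] // := dF t.
      by rewrite (lt_le_trans _ a)// (le_lt_trans b).
    have cF : {within `[p n, x - p n], continuous F}.
      by apply: derivable_within_continuous => t; rewrite in_itv/=; exact: dd.
    apply: (continuous_FTC2 (p_lt n)).
    - by move=> t; apply: continuousB; exact: subS.
    - have [] := (continuous_within_itvP _ (p_lt n)).1 cF; split => //.
      move=> t; rewrite in_itv/= => /andP[/ltW a /ltW b].
      by apply: dd; rewrite a.
    - move=> t; rewrite in_itv/= => /andP[a b]; rewrite derive1E.
      apply: derive_val; apply: dF.
      by rewrite (lt_trans _ a)// (lt_trans b).
  under eq_integral do rewrite EFinB.
  rewrite integralB_EFin;
    [|exact: measurable_itv|exact: (iS u n cu)|exact: (iS v n cv)].
  move=> /eqP; rewrite -EFinB sube_eq//; first by move/eqP.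
  by apply: (integrable_fin_num _ (iS u n cu)); exact: measurable_itv.
have vcvg := cvgS _ cv v0.
have FFcvg : (F (x - p n) - F (p n))%:E @[n --> \oo] --> (Fx - F0)%:E.
  apply: cvg_EFin; first by near=> n.
  apply: cvgB.
    move/cvg_at_leftP : FFx; apply; split=> //.
    by rewrite -[X in _ --> X]subr0; apply: cvgB => //; exact: cvg_cst.
  by move/cvg_at_rightP : FF0; apply; split.
(* Both integrals pass to the limit by monotone convergence; the sum of limits is defined because
   the increment of F has a finite limit. *)
apply: (cvg_unique _ (cvgS _ cu u0)) => //.
by rewrite (funext FTC); apply: cvgeD.
Unshelve. all: by end_near. Qed.

End ftc_oo.

(** * Derivative and end-point limits of t^a (1-t)^b *)

Section beta_kernel.
Context {R : realType}.
Implicit Types a b t x : R.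

Lemma is_derive_onem_powR b t : t < 1 ->
  is_derive t 1 (fun s => (1 - s) `^ b) (- (b * (1 - t) `^ (b - 1))).
Proof.
move=> t1; have t1' : 0 < 1 - t by rewrite subr_gt0.
have d1 : is_derive t 1 (fun s : R => 1 - s) (-1).
  by apply: is_derive_eq; rewrite add0r mul1r.
have := @is_derive1_comp _ (@powR R ^~ b) (fun s : R => 1 - s) t _ _
  (is_derive1_powR b t1') d1.
by rewrite mulrN1.
Qed.

Lemma is_derive_powR_onem a b t : 0 < t < 1 ->
  is_derive t 1 (fun s => s `^ a * (1 - s) `^ b)
    (a * t `^ (a - 1) * (1 - t) `^ b - b * t `^ a * (1 - t) `^ (b - 1)).
Proof.
move=> /andP[t0 t1].
have := @is_deriveM _ _ (@powR R ^~ a) (fun s => (1 - s) `^ b) t 1 _ _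
  (is_derive1_powR a t0) (is_derive_onem_powR b t1).
move=> h; apply: is_derive_eq.
by rewrite /GRing.scale/=; ring.
Qed.

Lemma continuous_powR a t : 0 < t -> {for t, continuous (@powR R ^~ a)}.
Proof.
move=> t0; have [d _] := is_derive1_powR a t0.
exact/differentiable_continuous/derivable1_diffP.
Qed.

Lemma continuous_onem_powR b t : t < 1 ->
  {for t, continuous (fun s : R => (1 - s) `^ b)}.
Proof.
move=> t1; have [d _] := is_derive_onem_powR b t1.
exact/differentiable_continuous/derivable1_diffP.
Qed.

Lemma continuous_powR_onem a b t : 0 < t < 1 ->
  {for t, continuous (fun s : R => s `^ a * (1 - s) `^ b)}.
Proof.
move=> /andP[t0 t1].
by apply: continuousM; [exact: continuous_powR|exact: continuous_onem_powR].
Qed.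

Lemma cvg_powR_onem_left a b x : 0 < x <= 1 -> 0 < b ->
  t `^ a * (1 - t) `^ b @[t --> x^'-] --> x `^ a * (1 - x) `^ b.
Proof.
move=> /andP[x0 x1] b0; have [x1'|x1'] := ltP x 1.
  by apply: cvg_at_left_filter; apply: continuous_powR_onem; rewrite x0.
have -> : x = 1 by apply/eqP; rewrite eq_le x1.
apply: cvgM.
  by apply: cvg_at_left_filter; exact: continuous_powR.
rewrite subrr powR0 ?gt_eqF//.
apply/cvg_at_leftP => u [u1 ul].
(* If u n < 1 tends to 1, then 1 - u n > 0 tends to 0, and the limit of s^b at 0 from the right
   applies. *)
have /cvg_at_rightP := powR_cvg0 b0; apply; split.
  by move=> n; rewrite subr_gt0.
by rewrite -[X in _ --> X](subrr 1); apply: cvgB => //; exact: cvg_cst.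
Qed.

Lemma cvg_powR_onem_right a b : 0 < a ->
  t `^ a * (1 - t) `^ b @[t --> 0^'+] --> (0 : R).
Proof.
move=> a0; rewrite -[X in _ --> X](mul0r ((1 - 0 : R) `^ b)); apply: cvgM.
  exact: powR_cvg0.
by apply: cvg_at_right_filter; exact: continuous_onem_powR.
Qed.

End beta_kernel.

(** * Recursions and finiteness of the incomplete beta integral *)

Section beta_integral.
Context {R : realType}.
Implicit Types a b s t x : R.
Local Notation mu := (@lebesgue_measure R).

(** Extended-real values let the recursions be proved before finiteness is known; finiteness is then
    deduced from them. *)
Definition beta_integral a b x : \bar R :=
  (\int[mu]_(t in `]0%R, x[) (t `^ (a - 1) * (1 - t) `^ (b - 1))%:E)%E.

Lemma incomplete_betaE a b x :
  incomplete_beta a b x = fine (beta_integral a b x).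
Proof. by []. Qed.

Lemma measurable_powR_onem a b (D : set R) :
  measurable_fun D (fun t => t `^ a * (1 - t) `^ b).
Proof.
apply: measurable_funTS; apply: measurable_funM; first exact: measurable_powR.
apply: (measurableT_comp (measurable_powR b)).
exact: measurable_funB.
Qed.

Lemma beta_integral_ge0 a b x : (0 <= beta_integral a b x)%E.
Proof.
by apply: integral_ge0 => t _; rewrite lee_fin mulr_ge0 ?powR_ge0.
Qed.

Lemma integralZl_powR_onem (k a b x : R) : 0 <= k ->
  (\int[mu]_(t in `]0%R, x[) (k * (t `^ (a - 1) * (1 - t) `^ (b - 1)))%:E =
   k%:E * beta_integral a b x)%E.
Proof.
move=> k0; rewrite -ge0_integralZl_EFin//.
- by move=> t _; rewrite lee_fin mulr_ge0 ?powR_ge0.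
- by apply/measurable_EFinP; exact: measurable_powR_onem.
Qed.

Let cont k a b x : x <= 1 ->
  {in `]0, x[, continuous (fun t => k * (t `^ (a - 1) * (1 - t) `^ (b - 1)))}.
Proof.
move=> x1 t; rewrite in_itv/= => /andP[t0 tx]; apply: cvgM.
  exact: cvg_cst.
by apply: continuous_powR_onem; rewrite t0 (lt_le_trans tx).
Qed.

Let ge0 k a b x : 0 <= k ->
  {in `]0, x[, forall t, 0 <= k * (t `^ (a - 1) * (1 - t) `^ (b - 1))}.
Proof. by move=> k0 t _; rewrite mulr_ge0// mulr_ge0 ?powR_ge0. Qed.

Let powRS a t : 0 < t -> t `^ a = t * t `^ (a - 1).
Proof.
move=> t0; rewrite -[X in X * _](powRr1 (ltW t0)) -powRD; last first.
  by rewrite (gt_eqF t0) implybT.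
by rewrite addrC subrK.
Qed.

(** Writing (1-t)^b = (1-t) (1-t)^(b-1), the derivative of t^a (1-t)^b becomes a t^(a-1) (1-t)^(b-1)
    - (a+b) t^a (1-t)^(b-1). *)
Lemma beta_integralSl a b x : 0 < a -> 0 < b -> 0 < x <= 1 ->
  (a%:E * beta_integral a b x =
   (x `^ a * (1 - x) `^ b)%:E + (a + b)%:E * beta_integral (a + 1) b x)%E.
Proof.
move=> a0 b0 /andP[x0 x1]; rewrite -!integralZl_powR_onem ?addr_ge0 ?ltW//.
rewrite -[X in X%:E]subr0.
apply: (@ge0_integral_oo_FTC2 _ (fun t => t `^ a * (1 - t) `^ b)) => //.
- exact: cont.
- exact: cont.
- by apply: ge0; rewrite ltW.
- by apply: ge0; rewrite addr_ge0 ?ltW.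
- move=> t /andP[t0 tx]; have t1 := lt_le_trans tx x1.
  have := @is_derive_powR_onem _ a b t; rewrite t0 t1 => /(_ isT) h.
  apply: is_derive_eq; rewrite addrK (powRS a)// (powRS b) ?subr_gt0//; ring.
- exact: cvg_powR_onem_right.
- by apply: cvg_powR_onem_left; rewrite ?x0.
Qed.

(** Here the product rule for - t^a (1-t)^b is integrated as it stands. *)
Lemma beta_integral_shift a b x : 0 < a -> 0 < b -> 0 < x <= 1 ->
  (b%:E * beta_integral (a + 1) b x =
   (- (x `^ a * (1 - x) `^ b))%:E + a%:E * beta_integral a (b + 1) x)%E.
Proof.
move=> a0 b0 /andP[x0 x1]; rewrite -!integralZl_powR_onem ?ltW//.
rewrite -[X in (X%:E + _)%E]subr0 -[X in ((_ - X)%:E + _)%E]oppr0.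
apply: (@ge0_integral_oo_FTC2 _ (fun t => - (t `^ a * (1 - t) `^ b))) => //.
- exact: cont.
- exact: cont.
- by apply: ge0; rewrite ltW.
- by apply: ge0; rewrite ltW.
- move=> t /andP[t0 tx]; have t1 := lt_le_trans tx x1.
  have := @is_derive_powR_onem _ a b t; rewrite t0 t1 => /(_ isT) h.
  apply: is_derive_eq; rewrite !addrK; ring.
- by apply: cvgN; exact: cvg_powR_onem_right.
- by apply: cvgN; apply: cvg_powR_onem_left; rewrite ?x0.
Qed.

Lemma beta_integral1 a x : 0 < a -> 0 < x <= 1 ->
  (a%:E * beta_integral a 1 x = (x `^ a)%:E)%E.
Proof.
move=> a0 /andP[x0 x1]; rewrite -integralZl_powR_onem ?ltW//.
(* The right-hand side is padded with the limit 0 at the origin and the integral of v = 0. *)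
rewrite -[RHS]adde0 -[X in _ = (X%:E + _)%E]subr0.
rewrite -[X in (_ + X)%E](@integral0 _ _ _ mu `]0%R, x[%classic).
apply: (@ge0_integral_oo_FTC2 _ (fun t => t `^ a) _ (cst 0)) => //.
- exact: cont.
- by move=> t _; exact: cst_continuous.
- by apply: ge0; rewrite ltW.
- move=> t /andP[t0 tx]; have h := is_derive1_powR a t0.
  by apply: is_derive_eq; rewrite subrr powRr0 mulr1 subr0.
- exact: powR_cvg0.
- by apply: cvg_at_left_filter; exact: continuous_powR.
Qed.

Lemma beta_integral_le1 a b x : 1 <= b -> x <= 1 ->
  (beta_integral a b x <= beta_integral a 1 x)%E.
Proof.
move=> b1 x1; apply: ge0_le_integral => //.
- by move=> t _; rewrite lee_fin mulr_ge0 ?powR_ge0.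
- by apply/measurable_EFinP; exact: measurable_powR_onem.
- by apply/measurable_EFinP; exact: measurable_powR_onem.
- move=> t; rewrite /= in_itv/= => /andP[t0 tx]; have t1 := lt_le_trans tx x1.
  rewrite lee_fin ler_wpM2l ?powR_ge0//.
  apply: ger_powR; last by rewrite lerB.
  by rewrite subr_gt0 t1/= lerBlDr lerDl ltW.
Qed.

(* For b < 1, finiteness propagates from (a, b + 1) to (a + 1, b) and from there
   to (a, b). *)
Lemma beta_integral_fin_num a b x : 0 < a -> 0 < b -> 0 < x <= 1 ->
  beta_integral a b x \is a fin_num.
Proof.
move=> a0 b0 x01; have [x0 x1] := andP x01.
have fin1 a' : 0 < a' -> beta_integral a' 1 x \is a fin_num.
  move=> a'0; rewrite ge0_fin_numE ?beta_integral_ge0//.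
  rewrite -(@lte_pmul2l _ a'%:E)// beta_integral1//.
  by rewrite mulry gtr0_sg// mul1e ltry.
have fin2 b' : 1 <= b' -> beta_integral a b' x \is a fin_num.
  move=> b'1; rewrite ge0_fin_numE ?beta_integral_ge0//.
  apply: le_lt_trans (beta_integral_le1 _ b'1 x1) _.
  by rewrite -ge0_fin_numE ?beta_integral_ge0 ?fin1.
(* The recursions bound positive multiples of the integral only; this removes the factor. *)
have fin3 k a' b' : 0 < k -> (k%:E * beta_integral a' b' x)%E \is a fin_num ->
    beta_integral a' b' x \is a fin_num.
  move=> k0; rewrite !ge0_fin_numE ?mule_ge0 ?beta_integral_ge0 ?lee_fin ?ltW//.
  move=> h; rewrite -(@lte_pmul2l _ k%:E)//.
  by rewrite [ltRHS]mulry gtr0_sg// mul1e.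
apply: (fin3 a) => //; rewrite beta_integralSl//.
rewrite fin_numD fin_numM// (fin3 b)// beta_integral_shift//.
by rewrite fin_numD fin_numM// fin2// lerDr ltW.
Qed.

End beta_integral.

(** * Affine change of variables on the real line *)

Section affine_substitution.
Context {R : realType}.
Local Notation mu := (@lebesgue_measure R).

(** The image of Lebesgue measure under t -> c t + d, scaled by c, gives each interval ]x, y] its
    length, so it is Lebesgue measure by uniqueness. *)
Lemma ge0_integral_affine (f : R -> R) (c d : R) : 0 < c ->
  measurable_fun setT f -> (forall t, 0 <= f t) ->
  (\int[mu]_t (f t)%:E = c%:E * \int[mu]_t (f (c * t + d))%:E)%E.
Proof.
move=> c0 mf f0.
pose phi : measurableTypeR R -> measurableTypeR R := fun t => c * t + d.
have mphi : measurable_fun setT phi.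
  by apply: measurable_funD => //; exact: measurable_funM.
have cge0 : 0 <= c by rewrite ltW.
pose cn : {nonneg R} := NngNum cge0.
rewrite (eq_measure_integral (mscale cn (pushforward mu phi))) => [|A mA _].
  rewrite ge0_integral_mscale//=; last 2 first.
  - exact/measurable_EFinP.
  - by move=> t _; rewrite lee_fin.
  rewrite ge0_integral_pushforward//=.
  - exact/measurable_EFinP.
  - by move=> t _; rewrite lee_fin.
apply: lebesgue_measure_unique => //= _ [[x y] _ <-].
rewrite /mscale/= /pushforward.
have -> : phi @^-1` `]x, y]%classic = `](x - d) / c, (y - d) / c]%classic.
  apply/seteqP; split=> t; rewrite /= /phi !in_itv/=;
    rewrite ltr_pdivrMr// ler_pdivlMr//;
    by rewrite ltrBlDr lerBrDr (mulrC t).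
rewrite !lebesgue_measure_itv/= !lte_fin ltr_pM2r ?invr_gt0// ltrD2r.
case: ifPn => _; last by rewrite mule0.
by rewrite -!EFinB -EFinM; congr EFin; field; rewrite gt_eqF.
Qed.

End affine_substitution.

(** * The gamma function and its relation to the beta integral *)

Section gamma_beta.
Context {R : realType}.
Implicit Types a b s t x : R.
Local Notation mu := (@lebesgue_measure R).

Definition gamma_integral s : \bar R :=
  (\int[mu]_(t in `]0%R, +oo[) (t `^ (s - 1) * expR (- t))%:E)%E.

Lemma GammaE s : Gamma s = fine (gamma_integral s).
Proof. by []. Qed.

Lemma gamma_integral_ge0 s : (0 <= gamma_integral s)%E.
Proof.
by apply: integral_ge0 => t _; rewrite lee_fin mulr_ge0 ?powR_ge0 ?expR_ge0.
Qed.

(** Extension by zero to the whole line, so that Tonelli and substitutions need no bookkeeping of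
    domains; the density is not normalized. *)
Definition gamma_density s : R -> R :=
  (fun t => t `^ (s - 1) * expR (- t)) \_ `]0, +oo[.

Definition beta_density a b : R -> R :=
  (fun t => t `^ (a - 1) * (1 - t) `^ (b - 1)) \_ `]0, 1[.

Lemma gamma_density_ge0 s t : 0 <= gamma_density s t.
Proof.
by apply: restrict_ge0 => u _; rewrite mulr_ge0 ?powR_ge0 ?expR_ge0.
Qed.

Lemma beta_density_ge0 a b t : 0 <= beta_density a b t.
Proof. by apply: restrict_ge0 => u _; rewrite mulr_ge0 ?powR_ge0. Qed.

Lemma measurable_gamma_density s : measurable_fun setT (gamma_density s).
Proof.
apply/(measurable_restrictT _ _).1 => //.
apply: measurable_funTS; apply: measurable_funM; first exact: measurable_powR.
by apply: measurableT_comp => //; exact: measurableT_comp.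
Qed.

Lemma measurable_beta_density a b : measurable_fun setT (beta_density a b).
Proof.
by apply/(measurable_restrictT _ _).1 => //; exact: measurable_powR_onem.
Qed.

Lemma gamma_integralE s :
  gamma_integral s = (\int[mu]_t (gamma_density s t)%:E)%E.
Proof. by rewrite /gamma_integral integral_mkcond restrict_EFin. Qed.

Lemma beta_integralE a b :
  beta_integral a b 1 = (\int[mu]_t (beta_density a b t)%:E)%E.
Proof. by rewrite /beta_integral integral_mkcond restrict_EFin. Qed.

Lemma gamma_density_le0 s t : t <= 0 -> gamma_density s t = 0.
Proof.
by move=> t0; rewrite /gamma_density patchE memNset//= in_itv/= ltNge t0.
Qed.

Lemma gamma_density_gt0 s t :
  0 < t -> gamma_density s t = t `^ (s - 1) * expR (- t).
Proof. by move=> t0; rewrite /gamma_density patchE mem_set//= in_itv/= t0. Qed.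

(** The integrand of the convolution under s = u w, with Jacobian u. Outside 0 < w < 1 both sides
    vanish; inside, the exponentials multiply to exp(-u) and the powers of u to u^(a+b-1). *)
Lemma gamma_density_scale a b u w : 0 < u ->
  u * (gamma_density a (u * w) * gamma_density b (u - u * w)) =
  gamma_density (a + b) u * beta_density a b w.
Proof.
move=> u0; have [w0|w0] := leP w 0.
  rewrite gamma_density_le0 ?pmulr_rle0// /beta_density.
  rewrite patchE memNset ?mul0r ?mulr0//.
  by rewrite /= in_itv/= ltNge w0.
have [w1|w1] := ltP w 1; last first.
  rewrite (@gamma_density_le0 b) ?subr_le0 ?ler_peMr ?(ltW u0)//.
  rewrite /beta_density patchE memNset ?mulr0//.
  by rewrite /= in_itv/= ltNge (_ : (w < 1) = false) ?andbF// ltNge w1.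
have uw0 : 0 < u * w by rewrite mulr_gt0.
have ww0 : 0 < 1 - w by rewrite subr_gt0.
have -> : u - u * w = u * (1 - w) by rewrite mulrBr mulr1.
rewrite !gamma_density_gt0 ?mulr_gt0//.
rewrite /beta_density patchE mem_set; last by rewrite /= in_itv/= w0.
rewrite !powRM ?ltW//.
have -> : expR (- u) = expR (- (u * w)) * expR (- (u * (1 - w))).
  by rewrite -expRD; congr expR; ring.
have -> : u `^ (a + b - 1) = u * (u `^ (a - 1) * u `^ (b - 1)).
  rewrite -powRD; last by rewrite (gt_eqF u0) implybT.
  rewrite -[X in X * _](powRr1 (ltW u0)) -powRD; last first.
    by rewrite (gt_eqF u0) implybT.
  by congr powR; ring.
ring.
Qed.

(** The double integral of g_a(s) g_b(u-s), with g the gamma density, is computed in both orders: u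
    first gives the left side, s first gives the right side. *)
Lemma gamma_integralM a b : 0 < a -> 0 < b ->
  (gamma_integral a * gamma_integral b =
   gamma_integral (a + b) * beta_integral a b 1)%E.
Proof.
move=> a0 b0; rewrite beta_integralE !gamma_integralE.
have mg s := measurable_gamma_density s.
have g0 s := gamma_density_ge0 s.
have mshift (c d : R) : measurable_fun setT (fun t : R => c * t + d).
  by apply: measurable_funD => //; exact: measurable_funM.
rewrite -ge0_integralZr//; last 3 first.
- by apply/measurable_EFinP; exact: mg.
- by move=> t _; rewrite lee_fin g0.
- by apply: integral_ge0 => t _; rewrite lee_fin g0.
transitivity (\int[mu]_s \int[mu]_u
    (gamma_density a s * gamma_density b (u - s))%:E)%E.
  apply: eq_integral => s _.
  rewrite (ge0_integral_affine (- s) ltr01 (mg b) (g0 b)) mul1e.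
  rewrite -ge0_integralZl_EFin; last 3 first.
  - by move=> t _; rewrite lee_fin g0.
  - by apply/measurable_EFinP; apply: (measurableT_comp (mg b)); exact: mshift.
  - exact: g0.
  - by apply: eq_integral => u _; rewrite mul1r.
  - exact: measurableT.
pose f (p : R * R) := (gamma_density a p.1 * gamma_density b (p.2 - p.1))%:E.
(* From here on s is the inner variable. *)
rewrite (@fubini_tonelli _ _ _ _ _ mu mu f); last 2 first.
- apply/measurable_EFinP; apply: measurable_funM.
    exact: (measurableT_comp (mg a)).
  by apply: (measurableT_comp (mg b)); exact: measurable_funB.
- by move=> p; rewrite lee_fin mulr_ge0 ?g0.
rewrite -ge0_integralZr//; last 3 first.
- by apply/measurable_EFinP; exact: mg.
- by move=> t _; rewrite lee_fin g0.
- by apply: integral_ge0 => t _; rewrite lee_fin beta_density_ge0.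
apply: eq_integral => u _; rewrite /f/=.
(* For u <= 0, s and u - s cannot both be positive, so the integrand is zero. *)
have [u0|u0] := leP u 0.
  rewrite (gamma_density_le0 _ u0) mul0e integral0_eq// => s _.
  have [s0|s0] := leP s 0; first by rewrite gamma_density_le0 ?mul0r.
  by rewrite (@gamma_density_le0 b) ?mulr0// subr_le0 (le_trans u0) ?ltW.
(* Substitution s = u w in the inner integral. *)
rewrite (@ge0_integral_affine _ _ u 0)//; last 2 first.
- apply: measurable_funM; first exact: mg.
  by apply: (measurableT_comp (mg b)); exact: measurable_funB.
- by move=> t; rewrite mulr_ge0 ?g0.
rewrite -!ge0_integralZl_EFin//; last first.
- exact: ltW.
- apply/measurable_EFinP; apply: measurable_funM.
    by apply: (measurableT_comp (mg a)); exact: mshift.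
  by apply: (measurableT_comp (mg b)); apply: measurable_funB => //;
    exact: mshift.
- by move=> t _; rewrite lee_fin mulr_ge0 ?g0.
- by apply/measurable_EFinP; exact: measurable_beta_density.
- by move=> t _; rewrite lee_fin beta_density_ge0.
by apply: eq_integral => w _; rewrite addr0 -!EFinM gamma_density_scale.
Qed.

(** This is the total mass of the exponential distribution of rate 1. *)
Lemma gamma_integral1 : gamma_integral 1 = 1%E.
Proof.
transitivity (\int[mu]_(t in `[0%R, +oo[) (1 * expR (- 1 * t))%:E)%E;
  last first.
  rewrite -(@integral_exponential_pdf R 1 ltr01).
  by rewrite integral_mkcond restrict_EFin.
under [RHS]eq_integral do rewrite mul1r mulN1r.
rewrite -integral_itv_obnd_cbnd.
  by apply: eq_integral => t _; rewrite subrr powRr0 mul1r.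
apply/measurable_EFinP/measurable_funTS.
by apply: measurableT_comp => //; exact: measurableT_comp.
Qed.

Lemma incomplete_beta_gt0 a b x : 0 < a -> 0 < b -> 0 < x <= 1 ->
  0 < incomplete_beta a b x.
Proof.
move=> a0 b0 x01; rewrite incomplete_betaE fine_gt0//.
rewrite andbC -ge0_fin_numE ?beta_integral_ge0// beta_integral_fin_num//=.
have /andP[x0 x1] := x01.
have x20 : 0 < x / 2 by rewrite divr_gt0.
have x21 : x / 2 < 1 by rewrite ltr_pdivrMr// mul1r (le_lt_trans x1)// ltr1n.
(* The boundary term of the recursion gives positivity, but it vanishes at x = 1; hence the detour
   through x / 2 < 1. *)
apply: (@lt_le_trans _ _ (beta_integral a b (x / 2))).
  rewrite -(@lte_pmul2l _ a%:E)// mule0 beta_integralSl ?x20 ?(ltW x21)//.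
  rewrite (@lt_le_trans _ _ ((x / 2) `^ a * (1 - x / 2) `^ b)%:E)//.
    by rewrite lte_fin mulr_gt0// powR_gt0// subr_gt0.
  by rewrite leeDl// mule_ge0 ?beta_integral_ge0// lee_fin addr_ge0// ltW.
apply: ge0_subset_integral => //.
- by apply/measurable_EFinP; exact: measurable_powR_onem.
- by move=> t _; rewrite lee_fin mulr_ge0 ?powR_ge0.
- apply: subset_itvl; rewrite bnd_simp.
  by rewrite ler_pdivrMr// ler_peMr ?ler1n// ltW.
Qed.

(** The product formula with second argument 1, where s B(s,1) = 1, replaces an integration by
    parts. *)
Lemma gamma_integralS s : 0 < s ->
  (gamma_integral (s + 1) = s%:E * gamma_integral s)%E.
Proof.
move=> s0; have := gamma_integralM s0 ltr01.
rewrite gamma_integral1 mule1 => ->.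
rewrite muleCA beta_integral1 ?ltr01 ?lexx//.
by rewrite powR1 mule1.
Qed.

Lemma gamma_integral_nat (n : nat) : gamma_integral n.+1%:R = n`!%:R%:E.
Proof.
elim: n => [|n IH]; first exact: gamma_integral1.
by rewrite -(natr1 n.+1) gamma_integralS// IH -EFinM -natrM factS.
Qed.

(* The product with gamma_integral (n + 1 - s) is n! B(s, n + 1 - s), hence
   finite and positive. *)
Lemma gamma_integral_fin_gt0 s : 0 < s ->
  (0 < gamma_integral s)%E /\ gamma_integral s \is a fin_num.
Proof.
move=> s0; have [n sn] : exists n : nat, s < n.+1%:R.
  by exists (Num.truncn s); rewrite truncnS_gt.
have ns0 : 0 < n.+1%:R - s by rewrite subr_gt0.
have := gamma_integralM s0 ns0.
rewrite (addrC s) subrK gamma_integral_nat.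
have := @incomplete_beta_gt0 s (n.+1%:R - s) 1 s0 ns0.
rewrite ltr01 lexx incomplete_betaE => /(_ isT).
have := @beta_integral_fin_num _ s (n.+1%:R - s) 1 s0 ns0.
rewrite ltr01 lexx => /(_ isT) /fineK <- /= B0.
rewrite -EFinM; have : 0 < n`!%:R * fine (beta_integral s (n.+1%:R - s) 1).
  by rewrite mulr_gt0// ltr0n fact_gt0.
move: (_ * _) => r r0.
(* Two nonnegative extended reals with a finite positive product are both nonzero, and neither can
   be infinite. *)
have := gamma_integral_ge0 s; have := gamma_integral_ge0 (n.+1%:R - s).
move: (gamma_integral s) (gamma_integral _) => x y y0 x0 xyr.
have xyN0 : (x * y != 0)%E by rewrite xyr eqe gt_eqF.
move: xyN0; rewrite mule_eq0 negb_or => /andP[xN0 yN0].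
have x1 : (0 < x)%E by rewrite lt_neqAle eq_sym xN0.
have y1 : (0 < y)%E by rewrite lt_neqAle eq_sym yN0.
split => //; rewrite ge0_fin_numE// ltey; apply/eqP => xoo.
by move: xyr; rewrite xoo gt0_mulye.
Qed.

Lemma Gamma_gt0 s : 0 < s -> 0 < Gamma s.
Proof.
move=> /gamma_integral_fin_gt0[g0 gfin]; rewrite GammaE fine_gt0// g0/=.
by rewrite ltey_eq gfin.
Qed.

Lemma GammaS s : 0 < s -> Gamma (s + 1) = s * Gamma s.
Proof.
move=> s0; have [_ gfin] := gamma_integral_fin_gt0 s0.
by rewrite !GammaE gamma_integralS// fineM.
Qed.

Lemma GammaM_beta a b : 0 < a -> 0 < b ->
  Gamma a * Gamma b = Gamma (a + b) * incomplete_beta a b 1.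
Proof.
move=> a0 b0; have [_ afin] := gamma_integral_fin_gt0 a0.
have [_ bfin] := gamma_integral_fin_gt0 b0.
have [_ abfin] := gamma_integral_fin_gt0 (addr_gt0 a0 b0).
rewrite !GammaE incomplete_betaE -(fineM afin bfin) (gamma_integralM a0 b0).
by rewrite (fineM abfin)// beta_integral_fin_num// ltr01 lexx.
Qed.

End gamma_beta.

(** * Algebra of partial sums of power series *)

Section pseries_partial_sums.
Context {R : realType}.
Implicit Types (c d : nat -> R) (x : R).

Lemma pseriesZ (k : R) c x n :
  pseries (fun i => k * c i) x n = k * pseries c x n.
Proof.
by rewrite /pseries /series/= mulr_sumr; apply: eq_bigr => i _; rewrite mulrA.
Qed.

Lemma pseriesB c d x n :
  pseries (fun i => c i - d i) x n = pseries c x n - pseries d x n.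
Proof.
rewrite /pseries /series/= -sumrB.
by apply: eq_bigr => i _; rewrite mulrBl.
Qed.

Lemma pseriesSr c x n : pseries c x n.+1 = pseries c x n + c n * x ^+ n.
Proof. by rewrite /pseries /series/= big_nat_recr. Qed.

Lemma pseriesSl c x n :
  pseries c x n.+1 = c 0%N + x * pseries (fun i => c i.+1) x n.
Proof.
rewrite /pseries /series/= big_nat_recl// expr0 mulr1 mulr_sumr; congr (_ + _).
by apply: eq_bigr => i _; rewrite exprS mulrCA.
Qed.

Lemma cvg_pseriesB c d (k h : R) x (l m : R) :
  pseries c x @ \oo --> l -> pseries d x @ \oo --> m ->
  pseries (fun i => k * c i - h * d i) x @ \oo --> k * l - h * m.
Proof.
move=> cl dm; rewrite (funext (pseriesB _ _ x)) (funext (pseriesZ k c x)).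
rewrite (funext (pseriesZ h d x)).
by apply: cvgB; apply: cvgM => //; exact: cvg_cst.
Qed.

End pseries_partial_sums.

(** * Power series of the normalized incomplete beta function and of one telescoped summand *)

Section incomplete_beta_series.
Context {R : realType}.
Implicit Types a b q x : R.

Lemma pochhammer0 (p : R) : pochhammer p 0 = 1.
Proof. by rewrite /pochhammer big_ord0. Qed.

Lemma pochhammerSr (p : R) n : pochhammer p n.+1 = pochhammer p n * (p + n%:R).
Proof. by rewrite /pochhammer big_ord_recr. Qed.

Lemma pochhammerSl (p : R) n : pochhammer p n.+1 = p * pochhammer (p + 1) n.
Proof.
rewrite /pochhammer big_ord_recl addr0; congr (_ * _).
by apply: eq_bigr => i _; rewrite -addrA -natr1 (addrC 1).
Qed.

Lemma pochhammer_gt0 (p : R) n : 0 < p -> 0 < pochhammer p n.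
Proof. by move=> p0; apply: prodr_gt0 => i _; rewrite ltr_wpDr. Qed.

Lemma ler_pochhammer (p q : R) n :
  0 <= p -> p <= q -> pochhammer p n <= pochhammer q n.
Proof. by move=> p0 pq; apply: ler_prod => i _; rewrite addr_ge0//= lerD2r. Qed.

(** The first factor grows strictly and the others weakly; the successor guarantees that a first
    factor exists. *)
Lemma ltr_pochhammerS (p q : R) n :
  0 < p -> p < q -> pochhammer p n.+1 < pochhammer q n.+1.
Proof.
move=> p0 pq; rewrite !pochhammerSl.
apply: lt_le_trans (_ : q * pochhammer (p + 1) n <= _).
  by rewrite ltr_pM2r// pochhammer_gt0// addr_gt0.
by rewrite ler_pM2l ?(lt_trans p0)// ler_pochhammer ?lerD2r ?ltW// addr_gt0.
Qed.

Lemma incomplete_betaSl a b x : 0 < a -> 0 < b -> 0 < x <= 1 ->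
  a * incomplete_beta a b x =
  x `^ a * (1 - x) `^ b + (a + b) * incomplete_beta (a + 1) b x.
Proof.
move=> a0 b0 x01; have := beta_integralSl a0 b0 x01.
rewrite -(fineK (beta_integral_fin_num a0 b0 x01)).
rewrite -(fineK (beta_integral_fin_num (addr_gt0 a0 ltr01) b0 x01)).
by rewrite -!EFinM -EFinD => -[].
Qed.

Lemma incomplete_beta_shift a b x : 0 < a -> 0 < b -> 0 < x <= 1 ->
  b * incomplete_beta (a + 1) b x =
  - (x `^ a * (1 - x) `^ b) + a * incomplete_beta a (b + 1) x.
Proof.
move=> a0 b0 x01; have := beta_integral_shift a0 b0 x01.
rewrite -(fineK (beta_integral_fin_num a0 (addr_gt0 b0 ltr01) x01)).
rewrite -(fineK (beta_integral_fin_num (addr_gt0 a0 ltr01) b0 x01)).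
by rewrite -!EFinM -EFinD => -[].
Qed.

(** Elimination of B_x(a+1,b) between the two preceding relations, after multiplication by a. *)
Lemma incomplete_betaSr a b x : 0 < a -> 0 < b -> 0 < x <= 1 ->
  (a + b) * incomplete_beta a (b + 1) x =
  b * incomplete_beta a b x + x `^ a * (1 - x) `^ b.
Proof.
move=> a0 b0 x01; have := incomplete_betaSl a0 b0 x01.
have := incomplete_beta_shift a0 b0 x01.
move: (_ * _ `^ b) (incomplete_beta _ b x) (incomplete_beta a b x) => X B' B.
move: (incomplete_beta _ _ _) => B'' h1 h2.
apply: (@mulfI _ a); first by rewrite gt_eqF.
transitivity ((a + b) * (a * B'')); first by ring.
have -> : a * B'' = b * B' + X by rewrite h1; ring.
transitivity (b * ((a + b) * B') + (a + b) * X); first by ring.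
have -> : (a + b) * B' = a * B - X by rewrite h2; ring.
ring.
Qed.

Lemma incomplete_beta_le_powR a b x : 0 < a -> 1 <= b -> 0 < x <= 1 ->
  a * incomplete_beta a b x <= x `^ a.
Proof.
move=> a0 b1 x01; have [_ x1] := andP x01; have b0 := lt_le_trans ltr01 b1.
rewrite -lee_fin -beta_integral1// EFinM incomplete_betaE.
rewrite (fineK (beta_integral_fin_num a0 b0 x01)).
by rewrite lee_pmul2l ?lte_fin ?beta_integral_le1.
Qed.

(** Coefficients of the hypergeometric series 2F1(a+b, 1; a+1; x), which equals a B_x(a,b) / (x^a
    (1-x)^b). *)
Definition beta_coef a b n : R := pochhammer (a + b) n / pochhammer (a + 1) n.

Lemma beta_coefS a b n : 0 < a ->
  beta_coef a b n.+1 * (a + n.+1%:R) = beta_coef a b n * (a + b + n%:R).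
Proof.
move=> a0; rewrite /beta_coef !pochhammerSr -natr1.
have p0 : pochhammer (a + 1) n != 0.
  by rewrite gt_eqF// pochhammer_gt0// addr_gt0.
have q0 : a + 1 + n%:R != 0 by rewrite gt_eqF// ltr_wpDr// addr_gt0.
by field; rewrite p0.
Qed.

(** The n-fold iteration of [incomplete_betaSl], with its remainder kept explicit. *)
Lemma incomplete_beta_partial_sum a b x n : 0 < a -> 0 < b -> 0 < x <= 1 ->
  a * incomplete_beta a b x =
  x `^ a * (1 - x) `^ b * pseries (beta_coef a b) x n +
  beta_coef a b n * ((a + n%:R) * incomplete_beta (a + n%:R) b x).
Proof.
move=> a0 b0 x01; have [x0 _] := andP x01.
elim: n => [|n IH].
  rewrite /pseries/= /series/= big_geq// mulr0 add0r addr0.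
  by rewrite /beta_coef !pochhammer0 divr1 mul1r.
rewrite IH pseriesSr.
have an0 : 0 < a + n%:R by rewrite ltr_wpDr.
rewrite (incomplete_betaSl an0 b0 x01).
have -> : a + n%:R + 1 = a + n.+1%:R by rewrite -addrA natr1.
rewrite powRD; last by rewrite (gt_eqF x0) implybT.
rewrite (powR_mulrn _ (ltW x0)) mulrA (beta_coefS _ _ a0).
ring.
Qed.

Lemma cvg_incomplete_beta_pseries a b x : 0 < a -> 1 <= b -> 0 < x < 1 ->
  pseries (beta_coef a b) x @ \oo -->
    a * incomplete_beta a b x / (x `^ a * (1 - x) `^ b).
Proof.
move=> a0 b1 /andP[x0 x1]; have b0 := lt_le_trans ltr01 b1.
have x01 : 0 < x <= 1 by rewrite x0 ltW.
set X := x `^ a * (1 - x) `^ b.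
have X0 : 0 < X by rewrite mulr_gt0// powR_gt0// subr_gt0.
pose rem n := beta_coef a b n * ((a + n%:R) * incomplete_beta (a + n%:R) b x).
have c0 n : 0 <= beta_coef a b n.
  by rewrite divr_ge0// ltW// pochhammer_gt0// addr_gt0.
have an0 n : 0 < a + n%:R by rewrite ltr_wpDr.
have rem0 n : 0 <= rem n.
  rewrite mulr_ge0// mulr_ge0//; first exact: ltW.
  by rewrite ltW// incomplete_beta_gt0.
have sumE n : pseries (beta_coef a b) x n =
    (a * incomplete_beta a b x - rem n) / X.
  rewrite (incomplete_beta_partial_sum n a0 b0 x01) -/X addrK mulrC mulKf//.
  by rewrite gt_eqF.
(* The partial sums increase and, the remainder being nonnegative, stay bounded. *)
have cvgs : cvgn (pseries (beta_coef a b) x).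
  apply: nondecreasing_is_cvgn.
    by apply: nondecreasing_series => n _ _; rewrite mulr_ge0// exprn_ge0// ltW.
  exists (a * incomplete_beta a b x / X) => _ [n _ <-].
  by rewrite sumE ler_pM2r ?invr_gt0// gerBl.
(* Since b >= 1, (a+n) B_x(a+n,b) <= x^(a+n), so the remainder is at most x^a times the n-th term of
   a series already known to converge. *)
have rem_cvg : rem @ \oo --> (0 : R).
  have t0 : x `^ a * (beta_coef a b n * x ^+ n) @[n --> \oo] --> (0 : R).
    rewrite -[X in _ --> X](mulr0 (x `^ a)); apply: cvgM; first exact: cvg_cst.
    exact: cvg_series_cvg_0.
  apply: squeeze_cvgr t0; last exact: cvg_cst.
  near=> n; rewrite rem0/= /rem [leRHS]mulrCA ler_wpM2l//.
  rewrite -powR_mulrn ?(ltW x0)// -powRD; last by rewrite (gt_eqF x0) implybT.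
  exact: incomplete_beta_le_powR.
rewrite (funext sumE); apply: cvgM; last exact: cvg_cst.
by rewrite -[X in _ --> X]subr0; apply: cvgB => //; exact: cvg_cst.
Unshelve. all: by end_near. Qed.

(** [incomplete_betaSr] is used at x for the numerators and at 1, where the boundary term is zero,
    for the denominators. *)
Lemma normalized_incomplete_betaS a q x : 0 < a -> 0 < q -> 0 < x < 1 ->
  normalized_incomplete_beta x a (q + 1) - normalized_incomplete_beta x a q =
  x `^ a * (1 - x) `^ q * (Gamma (a + q) / (Gamma a * Gamma (q + 1))).
Proof.
move=> a0 q0 /andP[x0 x1]; rewrite /normalized_incomplete_beta GammaS//.
have Ga := Gamma_gt0 a0; have Gq := Gamma_gt0 q0.
have Gaq := Gamma_gt0 (addr_gt0 a0 q0).
have B0 : 0 < incomplete_beta a q 1 by rewrite incomplete_beta_gt0// ltr01 lexx.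
have B1 : incomplete_beta a q 1 = Gamma a * Gamma q / Gamma (a + q).
  by rewrite GammaM_beta// mulrC mulKf// gt_eqF.
have aq0 : a + q != 0 by rewrite gt_eqF// addr_gt0.
have -> : incomplete_beta a (q + 1) 1 = q * incomplete_beta a q 1 / (a + q).
  have := @incomplete_betaSr a q 1 a0 q0; rewrite ltr01 lexx => /(_ isT).
  rewrite subrr powR0 ?gt_eqF// mulr0 addr0 => <-.
  by rewrite mulrC mulKf.
have -> : incomplete_beta a (q + 1) x =
    (q * incomplete_beta a q x + x `^ a * (1 - x) `^ q) / (a + q).
  by rewrite -incomplete_betaSr ?x0 ?ltW// mulrC mulKf.
rewrite B1; move: (incomplete_beta a q x) (Gamma a) (Gamma q) (Gamma (a + q))
  Ga Gq Gaq.
move=> {B0 B1} B ga gq gaq Ga Gq Gaq; field.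
by rewrite aq0 !gt_eqF.
Qed.

(** The constant in front is 1 / (a B(a,b)). *)
Lemma cvg_normalized_incomplete_beta a b x : 0 < a -> 1 <= b -> 0 < x < 1 ->
  pseries (fun n => Gamma (a + b) / (Gamma (a + 1) * Gamma b) *
                    beta_coef a b n) x @ \oo -->
    normalized_incomplete_beta x a b / (x `^ a * (1 - x) `^ b).
Proof.
move=> a0 b1 x01; have b0 := lt_le_trans ltr01 b1.
rewrite (funext (pseriesZ _ _ x)) /normalized_incomplete_beta.
have -> : incomplete_beta a b 1 = Gamma a * Gamma b / Gamma (a + b).
  by rewrite GammaM_beta// mulrC mulKf// gt_eqF// Gamma_gt0// addr_gt0.
set X := _ * _ `^ b.
have X0 : X != 0.
  have /andP[x0 x1] := x01.
  by rewrite gt_eqF// mulr_gt0// powR_gt0// subr_gt0.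
have -> : incomplete_beta a b x / (Gamma a * Gamma b / Gamma (a + b)) / X =
    Gamma (a + b) / (Gamma (a + 1) * Gamma b) * (a * incomplete_beta a b x / X).
  rewrite (GammaS a0).
  move: (Gamma_gt0 a0) (Gamma_gt0 b0) (Gamma_gt0 (addr_gt0 a0 b0)).
  move: (incomplete_beta a b x) (Gamma a) (Gamma b) (Gamma (a + b)).
  by move=> B ga gb gab ga0 gb0 gab0; field; rewrite X0 !gt_eqF.
by apply: cvgM; [exact: cvg_cst|exact: cvg_incomplete_beta_pseries].
Qed.

(** The j-th summand of the claimed formula, with q = b + j and r = b + beta + alpha - j - 1. *)
Definition turan_coef a q r k : R :=
  a * Gamma (a + q) * Gamma (a + r)
  / (Gamma (a + 1) ^+ 2 * Gamma (q + 1) * Gamma (r + 1) * pochhammer (a + 1) k)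
  * (pochhammer (a + r) k.+1 - pochhammer (a + q) k.+1).

Lemma turan_coef_gt0 a q r k : 0 < a -> 0 < q -> q < r ->
  0 < turan_coef a q r k.
Proof.
move=> a0 q0 qr; have r0 := lt_trans q0 qr.
have a1 : 0 < a + 1 by rewrite addr_gt0.
rewrite mulr_gt0//; last by rewrite subr_gt0 ltr_pochhammerS ?ltrD2l ?addr_gt0.
have G s : 0 < s -> 0 < Gamma (s + 1) by move=> s0; exact/Gamma_gt0/addr_gt0.
have Gaq : 0 < Gamma (a + q) by exact/Gamma_gt0/addr_gt0.
have Gar : 0 < Gamma (a + r) by exact/Gamma_gt0/addr_gt0.
apply: divr_gt0; first exact: mulr_gt0 (mulr_gt0 a0 Gaq) Gar.
apply: mulr_gt0; last exact: pochhammer_gt0.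
apply: mulr_gt0; last exact: G.
apply: mulr_gt0; last exact: G.
exact/exprn_gt0/G.
Qed.

Lemma turan_coef_ge0 a q r k : 0 < a -> 0 < q -> q <= r ->
  0 <= turan_coef a q r k.
Proof.
move=> a0 q0; rewrite le_eqVlt => /predU1P[<-|qr].
  by rewrite /turan_coef subrr mulr0.
by rewrite ltW// turan_coef_gt0.
Qed.

(** Replacing I(q) and I(r) by I(q+1) and I(r+1) minus monomials cancels the product I(q+1) I(r+1).
    What remains is linear in I(q+1) and I(r+1), whose second arguments are at least 1, so their
    series are available for all q, r > 0. *)
Lemma cvg_turan_coef a q r x : 0 < a -> 0 < q -> 0 < r -> 0 < x < 1 ->
  pseries (turan_coef a q r) x @ \oo -->
    (normalized_incomplete_beta x a (q + 1) * normalized_incomplete_beta x a r -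
     normalized_incomplete_beta x a q * normalized_incomplete_beta x a (r + 1))
    / (x `^ (2 * a) * (1 - x) `^ (q + r + 1)).
Proof.
move=> a0 q0 r0 x01; have /andP[x0 x1] := x01.
have x1' : 0 < 1 - x by rewrite subr_gt0.
have q1 : 1 <= q + 1 by rewrite lerDr ltW.
have r1 : 1 <= r + 1 by rewrite lerDr ltW.
have cq := cvg_normalized_incomplete_beta a0 q1 x01.
have cr := cvg_normalized_incomplete_beta a0 r1 x01.
have jq := normalized_incomplete_betaS a0 q0 x01.
have jr := normalized_incomplete_betaS a0 r0 x01.
pose kq := Gamma (a + q) / (Gamma a * Gamma (q + 1)).
pose kr := Gamma (a + r) / (Gamma a * Gamma (r + 1)).
pose cfq n := Gamma (a + (q + 1)) / (Gamma (a + 1) * Gamma (q + 1)) *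
  beta_coef a (q + 1) n.
pose cfr n := Gamma (a + (r + 1)) / (Gamma (a + 1) * Gamma (r + 1)) *
  beta_coef a (r + 1) n.
(* Gamma(a+r+1) (a+r+1)_k = Gamma(a+r) (a+r)_(k+1), and likewise for q. *)
have coefE : turan_coef a q r = fun k => kq * cfr k - kr * cfq k.
  apply/funext => k; rewrite /turan_coef /kq /kr /cfq /cfr /beta_coef.
  rewrite !pochhammerSl.
  have aq0 : 0 < a + q by rewrite addr_gt0.
  have ar0 : 0 < a + r by rewrite addr_gt0.
  rewrite !addrA (GammaS aq0) (GammaS ar0) (GammaS a0) (GammaS q0) (GammaS r0).
  have := pochhammer_gt0 k (addr_gt0 a0 ltr01).
  move: (Gamma_gt0 a0) (Gamma_gt0 q0) (Gamma_gt0 r0).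
  move: (Gamma a) (Gamma q) (Gamma r) (Gamma (a + q)) (Gamma (a + r)).
  move: (pochhammer _ k) (pochhammer _ k) (pochhammer _ k).
  move=> p1 p2 p3 ga gq gr gaq gar ga0 gq0 gr0 p0.
  by field; rewrite !gt_eqF.
rewrite coefE.
have -> : normalized_incomplete_beta x a q =
    normalized_incomplete_beta x a (q + 1) - x `^ a * (1 - x) `^ q * kq.
  by rewrite -jq subKr.
have -> : normalized_incomplete_beta x a r =
    normalized_incomplete_beta x a (r + 1) - x `^ a * (1 - x) `^ r * kr.
  by rewrite -jr subKr.
have := cvg_pseriesB (k := kq) (h := kr) cr cq.
move: (normalized_incomplete_beta x a (q + 1)).
move: (normalized_incomplete_beta x a (r + 1)) => Ir Iq cvg_coef.
rewrite [X in _ --> X](_ : _ = kq * (Ir / (x `^ a * (1 - x) `^ (r + 1))) -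
  kr * (Iq / (x `^ a * (1 - x) `^ (q + 1))))//.
have -> : x `^ (2 * a) = x `^ a * x `^ a.
  by rewrite mulr_natl mulr2n powRD// (gt_eqF x0) implybT.
rewrite !powRD ?(gt_eqF x1') ?implybT// powRr1 ?(ltW x1')//.
by field; rewrite (gt_eqF x1') !gt_eqF ?powR_gt0.
Qed.

End incomplete_beta_series.

(** * Uniqueness of power series coefficients on (0,1) *)

Section pseries_uniqueness.
Context {R : realType}.
Implicit Types (c d : nat -> R) (x : R).

Lemma sum_geometric_le2 x n : 0 <= x -> 2 * x <= 1 ->
  \sum_(0 <= i < n) x ^+ i <= 2.
Proof.
(* The bound is sharpened so that the induction closes, using 2 x <= 1. *)
move=> x0 x1; suff : \sum_(0 <= i < n) x ^+ i <= 2 * (1 - x ^+ n).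
  by move=> /le_trans; apply; rewrite ler_piMr// gerBl exprn_ge0.
elim: n => [|n IH]; first by rewrite big_geq// expr0 subrr mulr0.
rewrite big_nat_recr//= exprS.
have xn0 : 0 <= x ^+ n by rewrite exprn_ge0.
have : 2 * x * x ^+ n <= 1 * x ^+ n by rewrite ler_wpM2r.
lra.
Qed.

(** Convergence at 1/2 bounds |c_i| by M 2^i, so for x <= 1/4 the partial sums differ from c_0 by at
    most 4 M x. In the limit |c_0| <= 4 M x for all small x > 0. *)
Lemma pseries_coef0_eq0 c :
  (forall x, 0 < x < 1 -> pseries c x @ \oo --> (0 : R)) -> c 0%N = 0.
Proof.
move=> c0; have half01 : 0 < (2^-1 : R) < 1.
  by rewrite invr_gt0 ltr0n invf_lt1 ?ltr0n// ltr1n.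
have [M M0 cM] : exists2 M : R, 0 < M & forall i, `|c i * 2^-1 ^+ i| <= M.
  have /cvg_seq_bounded[M [_ bM]] : cvgn (fun i => c i * 2^-1 ^+ i).
    apply/cvg_ex; exists 0; apply: cvg_series_cvg_0.
    by apply/cvg_ex; exists 0; exact: c0.
  exists (`|M| + 1); first by rewrite ltr_pwDr.
  by move=> i; apply: bM => //; rewrite (le_lt_trans (ler_norm M))// ltrDl.
have tail x n : 0 < x -> 4 * x <= 1 -> `|pseries c x n.+1 - c 0%N| <= 4 * M * x.
  move=> x0 x4; rewrite pseriesSl addrAC subrr add0r normrM (gtr0_norm x0).
  rewrite [leRHS]mulrC ler_pM2l//.
  rewrite /pseries /series/=; apply: le_trans (ler_norm_sum _ _ _) _.
  (* After one factor x is taken out, the terms satisfy |c_(i+1)| x^i <= M 2^(i+1) x^i. *)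
  apply: (@le_trans _ _ (\sum_(0 <= i < n) 2 * M * (2 * x) ^+ i)).
    apply: ler_sum => i _; rewrite normrM (ger0_norm (exprn_ge0 _ (ltW x0))).
    rewrite exprMn mulrA ler_wpM2r ?exprn_ge0 ?(ltW x0)//.
    have := cM i.+1; rewrite normrM.
    rewrite [X in _ * X]ger0_norm ?exprn_ge0 ?invr_ge0//.
    rewrite exprVn ler_pdivrMr ?exprn_gt0// exprS => /le_trans; apply.
    by rewrite mulrCA mulrA.
  rewrite -mulr_sumr.
  have := @sum_geometric_le2 (2 * x) n.
  rewrite mulr_ge0 ?(ltW x0)// => /(_ isT).
  have -> : 2 * (2 * x) = 4 * x by ring.
  move=> /(_ x4) h; apply: le_trans (_ : 2 * M * 2 <= _); last by lra.
  by rewrite ler_wpM2l// mulr_ge0// ltW.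
have bound x : 0 < x -> 4 * x <= 1 -> `|c 0%N| <= 4 * M * x.
  move=> x0 x4; have x01 : 0 < x < 1 by rewrite x0/=; lra.
  have := c0 _ x01; rewrite -(cvg_shiftS (pseries c x)) => cv.
  have cv' : `|pseries c x n.+1 - c 0%N| @[n --> \oo] --> `|0 - c 0%N|.
    by apply: cvg_norm; apply: cvgB => //; exact: cvg_cst.
  rewrite -normrN -sub0r; apply: (cvgr_to_le cv').
  by near=> n; exact: tail.
apply/eqP; rewrite -normr_le0 leNgt; apply/negP => c0_gt0.
(* This choice gives 4 M x <= |c_0| / 2, contradicting the bound. *)
set x := Num.min (4^-1) (`|c 0%N| / (8 * M)).
have x0 : 0 < x by rewrite lt_min invr_gt0 ltr0n/= divr_gt0// mulr_gt0.
have x4 : 4 * x <= 1 by rewrite mulrC -ler_pdivlMr// mul1r ge_min lexx.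
have xM : 8 * M * x <= `|c 0%N|.
  by rewrite mulrC -ler_pdivlMr ?mulr_gt0// ge_min lexx orbT.
have := bound x x0 x4; lra.
Unshelve. all: by end_near. Qed.

(** Once c_0 = 0, division by x yields the shifted series with the same property; hence the
    induction generalizes over c. *)
Lemma pseries_coef_eq0 c :
  (forall x, 0 < x < 1 -> pseries c x @ \oo --> (0 : R)) -> forall k, c k = 0.
Proof.
move=> c0 k; elim: k c c0 => [|k IH] c c0; first exact: pseries_coef0_eq0.
apply: (IH (fun i => c i.+1)) => x x01; have /andP[x0 _] := x01.
have c00 := pseries_coef0_eq0 c0.
have -> : pseries (fun i => c i.+1) x = (fun n => x^-1 * pseries c x n.+1).
  by apply/funext => n; rewrite pseriesSl c00 add0r mulKf// gt_eqF.
rewrite -[X in _ --> X](mulr0 x^-1); apply: cvgM; first exact: cvg_cst.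
by rewrite (cvg_shiftS (pseries c x)); exact: c0.
Qed.

Lemma pseries_coef_inj c d (f : R -> R) :
  (forall x, 0 < x < 1 -> pseries c x @ \oo --> f x) ->
  (forall x, 0 < x < 1 -> pseries d x @ \oo --> f x) -> c = d.
Proof.
move=> cf df; apply/funext => k; apply/eqP; rewrite -subr_eq0; apply/eqP.
apply: (@pseries_coef_eq0 (fun k => c k - d k)) => x x01.
rewrite (funext (pseriesB _ _ x)).
by rewrite -[X in _ --> X](subrr (f x)); apply: cvgB; [exact: cf|exact: df].
Qed.

End pseries_uniqueness.

(** * Telescoping, positivity and comparison of coefficients *)

Lemma telescope_shifted_products (R : comNzRingType) (I : R -> R) (n : nat)
    (b c : R) :
  I (b + n%:R) * I (b + c) - I b * I (b + n%:R + c) =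
  \sum_(j < n) (I (b + j%:R + 1) * I (b + c + n%:R - j%:R - 1) -
                I (b + j%:R) * I (b + c + n%:R - j%:R - 1 + 1)).
Proof.
(* The two arguments move in opposite directions with constant sum; u n and u 0 are the two products
   on the left. *)
pose u (j : nat) := I (b + j%:R) * I (b + c + n%:R - j%:R).
transitivity (\sum_(0 <= j < n) (u j.+1 - u j)).
  rewrite telescope_sumr// /u addr0 subr0 addrK.
  by congr (_ - _ * I _); ring.
rewrite big_mkord; apply: eq_bigr => j _; rewrite /u subrK -natr1.
by congr (I _ * I _ - _); ring.
Qed.

Section turan_expansion.
Context {R : realType}.
Variables (alpha : nat) (a b beta : R).
Hypotheses (a_gt0 : 0 < a) (b_gt0 : 0 < b) (beta_gt0 : 0 < beta).

(** For every j, q + r + 1 = 2b + alpha + beta, so all summands share the same prefactor. *)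
Let q (j : nat) : R := b + j%:R.
Let r (j : nat) : R := b + beta + alpha%:R - j%:R - 1.

Let r_gt0 (j : 'I_alpha) : 0 < r j.
Proof.
have jle : j.+1%:R <= alpha%:R :> R by rewrite ler_nat.
by rewrite /r; move: b_gt0 beta_gt0 jle; rewrite -natr1; lra.
Qed.

Lemma turan_difference_telescope x :
  turan_difference a b alpha%:R beta x =
  \sum_(j < alpha) (normalized_incomplete_beta x a (q j + 1) *
                    normalized_incomplete_beta x a (r j) -
                    normalized_incomplete_beta x a (q j) *
                    normalized_incomplete_beta x a (r j + 1)).
Proof.
exact: telescope_shifted_products.
Qed.

Lemma cvg_turan_difference x : 0 < x < 1 ->
  pseries (fun k => \sum_(j < alpha) turan_coef a (q j) (r j) k) x @ \oo -->
    turan_difference a b alpha%:R beta x /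
      (x `^ (2 * a) * (1 - x) `^ (2 * b + alpha%:R + beta)).
Proof.
move=> x01; rewrite turan_difference_telescope mulr_suml.
have -> : pseries (fun k => \sum_(j < alpha) turan_coef a (q j) (r j) k) x =
    (fun n => \sum_(j < alpha) pseries (turan_coef a (q j) (r j)) x n).
  apply/funext => n; rewrite /pseries /series/= exchange_big/=.
  by apply: eq_bigr => i _; rewrite mulr_suml.
apply: cvg_big => [|j _]; first exact: add_continuous.
have -> : 2 * b + alpha%:R + beta = q j + r j + 1 by rewrite /q /r; ring.
by apply: cvg_turan_coef => //; rewrite ltr_wpDr.
Qed.

(** The condition q <= r reads 2j + 1 <= alpha + beta and follows from j <= alpha - 1 <= beta. It is
    strict at j = 0 because beta > 0; equality can occur at j = alpha - 1, so the other terms are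
    only claimed nonnegative. *)
Lemma turan_coef_sum_gt0 k : (0 < alpha)%N -> alpha%:R - 1 <= beta ->
  0 < \sum_(j < alpha) turan_coef a (q j) (r j) k.
Proof.
move=> alpha_gt0 alpha_le.
have q_gt0 j : 0 < q j by rewrite ltr_wpDr.
pose j0 := Ordinal alpha_gt0.
rewrite (bigD1 j0)//= ltr_pwDl//.
  apply: turan_coef_gt0 => //; have : 1 <= alpha%:R :> R by rewrite ler1n.
  by rewrite /q /r; move: beta_gt0; lra.
apply: sumr_ge0 => j _; apply: turan_coef_ge0 => //.
have : j.+1%:R <= alpha%:R :> R by rewrite ler_nat.
by rewrite /q /r; move: alpha_le; rewrite -natr1; lra.
Qed.

End turan_expansion.

Theorem corollary4 (R : realType) (alpha : nat) (a b beta : R)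
    (phi : nat -> R)
    (alpha_gt0 : (0 < alpha)%N) (a_gt0 : 0 < a) (b_gt0 : 0 < b)
    (beta_gt0 : 0 < beta)
    (phiE : turan_expansion a b alpha%:R beta phi) :
  (forall k : nat,
     phi k =
     \sum_(j < alpha)
       a * Gamma (a + b + j%:R) * Gamma (a + b + beta + alpha%:R - j%:R - 1)
       / (Gamma (a + 1) ^+ 2 * Gamma (b + j%:R + 1)
          * Gamma (b + beta + alpha%:R - j%:R) * pochhammer (a + 1) k)
       * (pochhammer (a + b + beta + alpha%:R - j%:R - 1) k.+1
          - pochhammer (a + b + j%:R) k.+1)) /\
  (alpha%:R - 1 <= beta -> forall k : nat, 0 < phi k).
Proof.
have phi_coef : phi = fun k => \sum_(j < alpha)
    turan_coef a (b + j%:R) (b + beta + alpha%:R - j%:R - 1) k.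
  (* Both series sum to the difference divided by its prefactor, which is nonzero on (0,1). *)
  apply: pseries_coef_inj (cvg_turan_difference a_gt0 b_gt0 beta_gt0) => x x01.
  have [cvg_phi ->] := phiE x x01; have /andP[x0 x1] := x01.
  rewrite mulrC mulKf//.
  by rewrite gt_eqF// mulr_gt0// powR_gt0// subr_gt0.
split=> [k|alpha_le k]; rewrite phi_coef; last exact: turan_coef_sum_gt0.
apply: eq_bigr => j _; rewrite /turan_coef subrK.
have -> : a + (b + j%:R) = a + b + j%:R by rewrite addrA.
have -> : a + (b + beta + alpha%:R - j%:R - 1) =
  a + b + beta + alpha%:R - j%:R - 1 by rewrite !addrA.
by [].
Qed.
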